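(* Let $p>5$ be a prime, $\alpha\in\mathbb{Z}_p$ with $p\nmid\alpha$. Let $a=\langle\alpha\rangle_p$ (so $1\le a\le p-1$) and $t=(\alpha-a)/p$. Then $$\sum_{k=1}^{p-1}\frac{H_k^{(2)}}{\alpha+k}\binom{\alpha}{k}\binom{-1-\alpha}{k}\equiv-\frac{1}{\alpha^3}+\frac{p^2t(t+1)}{\alpha a^2}\left(\frac{1}{\alpha^2}+\frac{2pH_a}{a^2}-\frac{p(2t+1)}{\alpha^2 a}+\frac{2}{3}pB_{p-3}\right)\pmod{p^4}.$$ Moreover, if $a\le(p-1)/2$, then $$\sum_{k=1}^{\frac{p-1}{2}}\frac{H_k^{(2)}}{\alpha+k}\binom{\alpha}{k}\binom{-1-\alpha}{k}\equiv-\frac{1}{\alpha^3}+\frac{pt}{\alpha a}\left(\frac{1}{\alpha^2}+\frac{7}{3}pB_{p-3}-\frac{pt}{\alpha^2 a}+\frac{2p}{a^2}\sum_{k=1}^{a}\frac{1}{2k-1}\right)\pmod{p^3}.$$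
   Context: $\mathbb{Z}_p$ is the ring of $p$-adic integers; for $x\in\mathbb{Z}_p$, $\langle x\rangle_p\in\{0,1,\dots,p-1\}$ denotes the unique integer with $x\equiv\langle x\rangle_p\pmod p$. For $x\in\mathbb{Z}_p$ and integer $k\ge0$, $\binom{x}{k}=x(x-1)\cdots(x-k+1)/k!$. For positive integers $r,n$, $H_n^{(r)}=\sum_{j=1}^n j^{-r}$, $H_0^{(r)}=0$, $H_n=H_n^{(1)}$. Bernoulli numbers: $\sum_{n\ge0}B_nt^n/n!=t/(e^t-1)$. Congruences modulo $p^m$ in $\mathbb{Z}_p$ mean the difference lies in $p^m\mathbb{Z}_p$. *)

(* Defs.v *)
From mathcomp Require Import all_boot all_order all_algebra.
Set Implicit Arguments. Unset Strict Implicit. Unset Printing Implicit Defensive.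
Import Order.TTheory GRing.Theory Num.Theory.
Local Open Scope ring_scope.

Definition padic (p : nat) := forall n : nat, 'Z_(p ^ n.+1).

Definition zp_coherent (p : nat) (x : padic p) : Prop :=
  forall n : nat, ((x n.+1 : nat) %% p ^ n.+1)%N = (x n : nat).

Definition zp_res (p : nat) (x : padic p) : nat := x 0%N.

(* t mod p^(n+1) = ((x mod p^(n+2)) - <x>_p)/p                               *)
Definition zp_t (p : nat) (x : padic p) : padic p :=
  fun n => (((x n.+1 : nat) - zp_res x) %/ p)%N%:R.

(* congruence modulo p^m (m >= 1) in Z_p: equality of images in Z/p^m Z     *)
Definition zp_eqmod (p m : nat) (x y : padic p) : Prop := x m.-1 = y m.-1.

Definition harm (r n : nat) : rat := \sum_(1 <= j < n.+1) (j%:R ^+ r)^-1.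

Definition oddharm (n : nat) : rat := \sum_(1 <= k < n.+1) ((2 * k - 1)%N%:R)^-1.

(* Bernoulli numbers with t/(e^t-1) = sum B_n t^n/n!, i.e. B_0 = 1 and
   sum_{j=0}^{n} C(n+1,j) B_j = 0 for n >= 1 *)
Fixpoint bernoulli_seq (n : nat) : seq rat :=
  match n with
  | 0 => [:: 1]
  | n'.+1 => let s := bernoulli_seq n' in
      rcons s (- (n'.+2%:R)^-1 * \sum_(j < n'.+1) 'C(n'.+2, j)%:R * s`_j)
  end.
Definition bernoulli (n : nat) : rat := (bernoulli_seq n)`_n.

Section Expr.
Variable R : comUnitRingType.

Definition binomR (x : R) (k : nat) : R :=
  (\prod_(i < k) (x - i%:R)) * ratr ((k`!)%:R^-1).

(* binom(-1-x, k)/(x+k) = (-1)^k (x+1)...(x+k-1)/k!   (the factor x+k of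
   binom(-1-x,k) = (-1)^k (x+1)...(x+k)/k! cancelled) *)
Definition binom_neg_div (x : R) (k : nat) : R :=
  (-1) ^+ k * (\prod_(1 <= i < k) (x + i%:R)) * ratr ((k`!)%:R^-1).

Definition summand (al : R) (k : nat) : R :=
  ratr (harm 2 k) * binomR al k * binom_neg_div al k.

Definition lhs (al : R) (N : nat) : R := \sum_(1 <= k < N.+1) summand al k.

Definition rhs1 (p a : nat) (al t : R) : R :=
  - (al ^+ 3)^-1
  + (p ^ 2)%N%:R * t * (t + 1) * (al^-1 * ratr ((a ^ 2)%N%:R^-1))
    * ( (al ^+ 2)^-1
      + 2%:R * p%:R * ratr (harm 1 a / (a ^ 2)%N%:R)
      - p%:R * (2%:R * t + 1) * ((al ^+ 2)^-1 * ratr (a%:R^-1))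
      + ratr (2%:R / 3%:R) * p%:R * ratr (bernoulli (p - 3)) ).

Definition rhs2 (p a : nat) (al t : R) : R :=
  - (al ^+ 3)^-1
  + p%:R * t * (al^-1 * ratr (a%:R^-1))
    * ( (al ^+ 2)^-1
      + ratr (7%:R / 3%:R) * p%:R * ratr (bernoulli (p - 3))
      - p%:R * t * ((al ^+ 2)^-1 * ratr (a%:R^-1))
      + 2%:R * p%:R * ratr ((a ^ 2)%N%:R^-1) * ratr (oddharm a) ).
End Expr.

Definition zp_lhs (p : nat) (al : padic p) (N : nat) : padic p :=
  fun n => lhs (al n) N.
Definition zp_rhs1 (p : nat) (al : padic p) : padic p :=
  fun n => rhs1 p (zp_res al) (al n) (zp_t al n).
Definition zp_rhs2 (p : nat) (al : padic p) : padic p :=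
  fun n => rhs2 p (zp_res al) (al n) (zp_t al n).

(* Main.v *)
(* With P_n(x) = prod_(j <= n) (1 - x^2/j^2), one has
     binom(x,k) binom(-1-x,k) / (x+k) = (P_k(x) - P_(k-1)(x)) / x = - x P_(k-1)(x) / k^2,
   so summation by parts collapses the sum to
     -1/x^3 + (P_n(x)/x) (1/x^2 + H_n^(2)).
   For x = a + p t the product P_n(x) is a quotient of rising factorials of the
   form prod_i (p z + i), which mod p^2 are m! (1 + p z H_m); its factors
   divisible by p are p t and, when n = p-1, also p (t+1).  Finally H_(p-1)^(2)
   and H_((p-1)/2)^(2) mod p^2 come from pairing j with p - j and the even j
   with the odd ones: this expresses both through the sum of 1/j^3 over
   j <= (p-1)/2 mod p, and the same relations for the powers j^(p-3), whose sum
   over j < p is p B_(p-3) mod p^2, identify that sum with -2 B_(p-3).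
   Only residues of alpha matter, so alpha may be taken to be a natural number
   and all of this happens among p-integral rationals. *)
Require Import Defs.
From HB Require Import structures.
From mathcomp Require Import all_boot all_order all_algebra.
From mathcomp Require Import ring zify.
Set Implicit Arguments. Unset Strict Implicit. Unset Printing Implicit Defensive.
Import Order.TTheory GRing.Theory Num.Theory.
Local Open Scope ring_scope.

(** * Rationals with denominator prime to p *)

Definition pint (p : nat) : pred rat := fun x => coprime p `|denq x|.

Lemma denq_nat (R : pzRingType) (x : rat) :
  (denq x)%:~R = `|denq x|%N%:R :> R.
Proof. by rewrite -[in LHS]absz_denq. Qed.

(** An unreduced fraction n/d is enough: [numq x * d = n * denq x] and Gauss's lemma make the
    reduced denominator divide d. *)
Lemma pintP p x (d : nat) (n : int) :
  (0 < d)%N -> coprime p d -> x * d%:R = n%:~R -> x \in pint p.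
Proof.
move=> d_gt0 cpd xd; apply: coprime_dvdr cpd.
suff: (denq x %| numq x * d)%Z.
  by rewrite Gauss_dvdzr // coprimez_sym; apply: coprime_num_den.
apply/dvdzP; exists n; apply: (@intr_inj rat).
by rewrite !intrM numqE -xd -!mulrA [_%:~R * _]mulrC.
Qed.

Fact pint_subring p : subring_closed (pint p).
Proof.
have dpos x : (0 < `|denq x|)%N by rewrite absz_gt0 denq_neq0.
split=> [|x y px py|x y px py]; first exact: coprimen1.
  apply: (@pintP p _ (`|denq x| * `|denq y|)
                 (numq x * denq y - numq y * denq x)).
  - by rewrite muln_gt0 !dpos.
  - by rewrite coprimeMr; apply/andP.
  by rewrite intrB !intrM !numqE natrM -!denq_nat; ring.
apply: (@pintP p _ (`|denq x| * `|denq y|) (numq x * numq y)).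
- by rewrite muln_gt0 !dpos.
- by rewrite coprimeMr; apply/andP.
by rewrite !intrM !numqE natrM -!denq_nat; ring.
Qed.

HB.instance Definition _ p := GRing.isSubringClosed.Build rat (pint p) (pint_subring p).

Lemma pint_natV p d : coprime p d -> (d%:R)^-1 \in pint p.
Proof.
case: d => [|d] cpd; first by rewrite invr0 rpred0.
by apply: (@pintP p _ d.+1 1) => //; rewrite mulVf ?pnatr_eq0.
Qed.

(** * Reduction of p-integral rationals into other rings *)

Definition reduces (p : nat) (R : comUnitRingType) (x : rat) (y : R) :=
  x \in pint p /\ ratr x = y.

Section Reduces.
Variables (p : nat) (R : comUnitRingType).
Implicit Types (x y : rat) (u v : R).
Hypothesis unitR : forall d, coprime p d -> (d%:R : R) \is a GRing.unit.

Lemma ratrM_denq x : x \in pint p -> ratr x * `|denq x|%:R = (numq x)%:~R :> R.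
Proof.
move=> px; rewrite /ratr -{1}absz_denq divrK ?unitR //.
Qed.

(** Cross-multiplying over the integers shows that any fraction n/d for x may be used in [R], not
    only the reduced one. Sums and products of reduced fractions need this, and [ratr] respects both
    for this reason. *)
Lemma reducesP x (d : nat) (n : int) : coprime p d -> x \in pint p ->
  x * d%:R = n%:~R -> ratr x * d%:R = n%:~R :> R.
Proof.
move=> cpd px xd; apply: (mulIr (unitR px)).
rewrite mulrAC ratrM_denq //.
have E : numq x * d = n * denq x.
  by apply: (@intr_inj rat); rewrite !intrM numqE -xd -!mulrA [_%:~R * _]mulrC.
have := congr1 (intmul (1 : R)) E.
by rewrite !intrM -[in X in _ = X](absz_denq x).
Qed.

Lemma reduces_natr n : @reduces p R n%:R n%:R.
Proof. by split; rewrite ?rpred_nat // ratr_nat. Qed.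

Lemma reduces0 : @reduces p R 0 0. Proof. exact: (reduces_natr 0). Qed.

Lemma reduces1 : @reduces p R 1 1. Proof. exact: (reduces_natr 1). Qed.

Lemma reducesN x u : reduces p x u -> reduces p (- x) (- u).
Proof.
by case=> px <-; split; rewrite ?rpredN // /ratr numqN denqN rmorphN mulNr.
Qed.

Lemma reducesD x u y v : reduces p x u -> reduces p y v ->
  reduces p (x + y) (u + v).
Proof.
move=> [px <-] [py <-]; have pxy := rpredD px py; split=> //.
have cpd : coprime p (`|denq x| * `|denq y|) by rewrite coprimeMr; apply/andP.
apply: (mulIr (unitR cpd)).
rewrite (@reducesP _ _ (numq x * denq y + numq y * denq x)) //.
  by rewrite natrM intrD !intrM -!ratrM_denq // !denq_nat; ring.
by rewrite natrM intrD !intrM !numqE -!denq_nat; ring.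
Qed.

Lemma reducesM x u y v : reduces p x u -> reduces p y v ->
  reduces p (x * y) (u * v).
Proof.
move=> [px <-] [py <-]; have pxy := rpredM px py; split=> //.
have cpd : coprime p (`|denq x| * `|denq y|) by rewrite coprimeMr; apply/andP.
apply: (mulIr (unitR cpd)).
rewrite (@reducesP _ _ (numq x * numq y)) //.
  by rewrite natrM !intrM -!ratrM_denq //; ring.
by rewrite natrM !intrM !numqE -!denq_nat; ring.
Qed.

Lemma reducesX x u n : reduces p x u -> reduces p (x ^+ n) (u ^+ n).
Proof.
move=> h; elim: n => [|n IHn]; first by rewrite !expr0; apply: reduces1.
by rewrite !exprS; apply: reducesM.
Qed.

(** Since x * x^-1 reduces to 1, the image of x^-1 is a true inverse of u, which is therefore a
    unit. *)
Lemma reducesV x u : x != 0 -> x^-1 \in pint p -> reduces p x u ->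
  reduces p x^-1 u^-1.
Proof.
move=> x0 pV h; split=> //.
have [_] := reducesM h (conj pV erefl); rewrite mulfV // -[1]/(1%:R) ratr_nat.
move=> uV; have uu : u \is a GRing.unit by apply/unitrPr; exists (ratr x^-1).
by apply: (mulrI uu); rewrite mulrV.
Qed.

Lemma reduces_sum (I : Type) (r : seq I) (P : pred I) (F : I -> rat) (G : I -> R) :
  (forall i, P i -> reduces p (F i) (G i)) ->
  reduces p (\sum_(i <- r | P i) F i) (\sum_(i <- r | P i) G i).
Proof.
move=> h; apply: (big_rec2 (@reduces p R)); first exact: reduces0.
by move=> i x y Pi; apply: reducesD; apply: h.
Qed.

Lemma reduces_prod (I : Type) (r : seq I) (P : pred I) (F : I -> rat) (G : I -> R) :
  (forall i, P i -> reduces p (F i) (G i)) ->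
  reduces p (\prod_(i <- r | P i) F i) (\prod_(i <- r | P i) G i).
Proof.
move=> h; apply: (big_rec2 (@reduces p R)); first exact: reduces1.
by move=> i x y Pi; apply: reducesM; apply: h.
Qed.

(** On the left [ratr] is the identity of [rat]; this form matches the constants of [lhs], [rhs1]
    and [rhs2], which are wrapped in [ratr] in every ring. *)
Lemma reduces_ratr x : x \in pint p -> reduces p (ratr x) (ratr x : R).
Proof.
by move=> px; rewrite /reduces [ratr x : rat]divq_num_den.
Qed.

End Reduces.

(** * Rising factorials and the closed form of the sum *)

Lemma harm_S r n : harm r n.+1 = harm r n + (n.+1%:R ^+ r)^-1.
Proof. by rewrite /harm big_nat_recr. Qed.

Lemma harm_0 r : harm r 0 = 0. Proof. by rewrite /harm big_geq. Qed.

Lemma natr_neq0 n : (0 < n)%N -> n%:R != 0 :> rat.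
Proof. by rewrite pnatr_eq0 lt0n. Qed.

(** The product starts at y + 1, so that [rising 0 n] is n! and [rising y n / n!] is close to 1 when
    p divides y. *)
Definition rising (y : rat) (n : nat) := \prod_(1 <= i < n.+1) (y + i%:R).

Lemma rising0 y : rising y 0 = 1. Proof. by rewrite /rising big_geq. Qed.

Lemma risingS y n : rising y n.+1 = rising y n * (y + n.+1%:R).
Proof. by rewrite /rising big_nat_recr. Qed.

Lemma rising_add z m n : rising z (m + n) = rising z m * rising (z + m%:R) n.
Proof.
elim: n => [|n IHn]; first by rewrite addn0 rising0 mulr1.
by rewrite addnS !risingS IHn -addnS natrD addrA mulrA.
Qed.

(** Replacing i by m + 1 - i turns each factor into -(z + i). *)
Lemma rising_reflect z m : rising (- z - m.+1%:R) m = (-1) ^+ m * rising z m.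
Proof.
have -> : (-1) ^+ m = \prod_(1 <= i < m.+1) (-1) :> rat.
  by rewrite prodr_const_nat subn1.
rewrite /rising big_nat_rev -big_split /=; apply: eq_big_nat => i /andP[i1 i2].
by rewrite subSS natrB; [ring|lia].
Qed.

Lemma fact_rising n : n`!%:R = rising 0 n.
Proof.
by elim: n => [|n IHn]; rewrite ?rising0 // factS risingS natrM IHn add0r mulrC.
Qed.

(** The partial products of Euler's product for sin(pi x)/(pi x). *)
Definition sq_prod (x : rat) (n : nat) := \prod_(1 <= j < n.+1) (1 - x ^+ 2 / j%:R ^+ 2).

Lemma sq_prodS x n : sq_prod x n.+1 = sq_prod x n * (1 - x ^+ 2 / n.+1%:R ^+ 2).
Proof. by rewrite /sq_prod big_nat_recr. Qed.

Lemma sq_prod0 x : sq_prod x 0 = 1. Proof. by rewrite /sq_prod big_geq. Qed.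

Lemma sq_prod_fact x n : n`!%:R ^+ 2 * sq_prod x n = rising (- x) n * rising x n.
Proof.
elim: n => [|n IHn]; first by rewrite sq_prod0 !rising0 expr1n.
have n0 : n.+1%:R != 0 :> rat by rewrite natr_neq0.
rewrite factS mulnC natrM sq_prodS !risingS exprMn mulrACA IHn.
by move: n.+1%:R n0 => c c0; field; rewrite c0.
Qed.

(** Put x = a + y. The factors j - x of [rising (- x) n] split at j = a: those before reflect to
    [rising y (a - 1)], j = a gives -y, those after give [rising (- y) (n - a)]. The extra factor a
    + y bridges [rising y (a - 1)] and [rising x n] into [rising y (n + a)]. *)
Lemma sq_prod_rising (y : rat) a n : (0 < a <= n)%N ->
  (a%:R + y) * n`!%:R ^+ 2 * sq_prod (a%:R + y) n
  = (-1) ^+ a * y * rising y (n + a) * rising (- y) (n - a).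
Proof.
case: a => [|b] // /subnKC <-; move: (n - b.+1)%N => c {n}.
rewrite addKn -mulrA sq_prod_fact [X in rising y X]addnC (rising_add y).
have -> : rising (- (b.+1%:R + y)) (b.+1 + c)
    = (-1) ^+ b * rising y b * - y * rising (- y) c.
  rewrite rising_add risingS -rising_reflect.
  by congr (rising _ _ * _ * rising _ _); ring.
by rewrite risingS [b.+1%:R + y]addrC exprS; ring.
Qed.

Lemma ratr_rat (x : rat) : ratr x = x. Proof. exact: divq_num_den. Qed.

Lemma summand_term (x : rat) k :
  binomR x k.+1 * binom_neg_div x k.+1 = - (x / k.+1%:R ^+ 2) * sq_prod x k.
Proof.
rewrite /binomR /binom_neg_div !ratr_rat.
elim: k => [|k IHk].
  by rewrite big_ord1 big_geq // sq_prod0 /= factS fact0; field.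
have k1 : k.+1%:R != 0 :> rat by rewrite natr_neq0.
have k2 : k.+2%:R != 0 :> rat by rewrite natr_neq0.
have f0 : k.+1`!%:R != 0 :> rat by rewrite natr_neq0 ?fact_gt0.
rewrite big_ord_recr big_nat_recr //= exprS (factS k.+1) natrM sq_prodS.
rewrite [RHS]mulrA; have -> : - (x / k.+2%:R ^+ 2) * sq_prod x k =
   (k.+1%:R / k.+2%:R) ^+ 2 * (- (x / k.+1%:R ^+ 2) * sq_prod x k).
  by move: k.+1%:R k.+2%:R k1 k2 => u v u0 v0; field; rewrite u0 v0.
rewrite -IHk; move: k.+1%:R k.+2%:R k.+1`!%:R k1 k2 f0 => u v w u0 v0 w0.
by field; rewrite u0 v0 w0.
Qed.

(** The right side vanishes at n = 0, and its increment from n to n + 1 is -x P_n(x) H_(n+1)^(2) /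
    (n+1)^2, the term given by [summand_term]. *)
Lemma lhs_closed (x : rat) n : x != 0 ->
  lhs x n = - (x ^+ 3)^-1 + sq_prod x n / x * ((x ^+ 2)^-1 + harm 2 n).
Proof.
move=> x0; elim: n => [|n IHn].
  by rewrite /lhs big_geq // sq_prod0 harm_0; field; rewrite x0.
have n0 : n.+1%:R != 0 :> rat by rewrite natr_neq0.
rewrite /lhs big_nat_recr //= -/(lhs x n) IHn /summand -(mulrA _ (binomR _ _)) summand_term.
rewrite ratr_rat sq_prodS harm_S.
by move: n.+1%:R n0 => c c0; field; rewrite c0 x0.
Qed.

(** * Bernoulli numbers, power sums and rearrangements of sums *)

Lemma size_bernoulli_seq n : size (bernoulli_seq n) = n.+1.
Proof. by elim: n => //= n IHn; rewrite size_rcons IHn. Qed.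

Lemma nth_bernoulli_seq n j : (j <= n)%N -> (bernoulli_seq n)`_j = bernoulli j.
Proof.
elim: n => [|n IHn]; first by rewrite leqn0 => /eqP ->.
rewrite leq_eqVlt => /orP[/eqP -> //|jn].
by rewrite /= nth_rcons size_bernoulli_seq jn IHn.
Qed.

Lemma bernoulliS n : bernoulli n.+1
  = - (n.+2%:R)^-1 * \sum_(j < n.+1) 'C(n.+2, j)%:R * bernoulli j.
Proof.
rewrite /bernoulli [bernoulli_seq n.+1]/= nth_rcons size_bernoulli_seq ltnn eqxx.
by congr (_ * _); apply: eq_bigr => j _; rewrite (@nth_bernoulli_seq n j) ?leq_ord.
Qed.

(** Telescope (j+1)^(m+1) - j^(m+1) over j < N and expand by the binomial theorem; the term j = 0
    counts with 0^0 = 1. *)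
Lemma power_sum_rec (m N : nat) : N%:R ^+ m.+1
  = \sum_(i < m.+1) 'C(m.+1, i)%:R * \sum_(0 <= j < N) j%:R ^+ i :> rat.
Proof.
have -> : N%:R ^+ m.+1 = \sum_(0 <= j < N) (j.+1%:R ^+ m.+1 - j%:R ^+ m.+1) :> rat.
  by rewrite (telescope_sumr (fun j => j%:R ^+ m.+1)) // expr0n subr0.
under [RHS]eq_bigr => i _ do rewrite mulr_sumr.
rewrite exchange_big /=; apply: eq_bigr => j _.
rewrite -nat1r exprDn big_ord_recr /= binn subnn mulr1n expr0 mul1r addrK.
by apply: eq_bigr => i _; rewrite expr1n mul1r mulr_natl.
Qed.

Lemma sum_fold (F : nat -> rat) n : \sum_(1 <= j < n.*2.+1) F j
  = \sum_(1 <= j < n.+1) F j + \sum_(1 <= j < n.+1) F (n.*2.+1 - j)%N.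
Proof.
rewrite (big_cat_nat (n := n.+1)) //=; last by lia.
congr (_ + _); rewrite -[n.+1]add1n big_addn big_nat_rev.
have -> : (n.*2.+1 - n = n.+1)%N by lia.
by apply: eq_big_nat => i /andP[i1 i2]; congr F; lia.
Qed.

Lemma sum_parity (F : nat -> rat) n : \sum_(1 <= j < n.*2.+1) F j
  = \sum_(1 <= j < n.+1) F j.*2 + \sum_(1 <= j < n.+1) F (n.*2.+1 - j.*2)%N.
Proof.
(* Reversal turns the index 2n + 1 - 2j into 2j - 1, which no longer depends on n, so induction on n
   applies. *)
rewrite [X in _ = _ + X]big_nat_rev /=.
have -> : \sum_(1 <= j < n.+1) F (n.*2.+1 - (1 + n.+1 - j.+1).*2)%N
    = \sum_(1 <= j < n.+1) F j.*2.-1.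
  by apply: eq_big_nat => i /andP[i1 i2]; congr F; lia.
elim: n => [|n IHn]; first by rewrite !big_geq // addr0.
rewrite doubleS (big_nat_recr n.*2.+2) // (big_nat_recr n.*2.+1) //.
by rewrite !(big_nat_recr n.+1) //= IHn; ring.
Qed.

Lemma pint_sum_nat p (m n : nat) (F : nat -> rat) :
  (forall i, (m <= i < n)%N -> F i \in pint p) -> \sum_(m <= i < n) F i \in pint p.
Proof. by move=> h; rewrite big_nat; apply: rpred_sum => i /h. Qed.

(** * Congruences modulo p^k between rationals *)

Definition eqm (p k : nat) (x y : rat) := (x - y) / p%:R ^+ k \in pint p.

Section Congruence.
Variable p : nat.
Hypothesis p_pr : prime p.
Implicit Types (k : nat) (x y z u v : rat).

Let p0 : p%:R != 0 :> rat.
Proof. by rewrite pnatr_eq0 -lt0n prime_gt0. Qed.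

Let pX0 k : p%:R ^+ k != 0 :> rat. Proof. exact: expf_neq0. Qed.

Lemma coprime_lt d : (0 < d < p)%N -> coprime p d.
Proof.
by move=> /andP[d0 dp]; rewrite prime_coprime // gtnNdvd.
Qed.

Lemma pint_ltV d : (d < p)%N -> (d%:R)^-1 \in pint p.
Proof.
case: d => [|d] dp; first by rewrite invr0 rpred0.
by apply/pint_natV/coprime_lt.
Qed.

Lemma eqmP k x y : reflect (exists2 z, z \in pint p & x = y + p%:R ^+ k * z) (eqm p k x y).
Proof.
apply: (iffP idP) => [h|[z pz ->]].
  by exists ((x - y) / p%:R ^+ k) => //; rewrite mulrC divfK // addrC subrK.
by rewrite /eqm addrC addKr mulrC mulKf.
Qed.

Lemma eqm_refl k x : eqm p k x x. Proof. by rewrite /eqm subrr mul0r rpred0. Qed.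

Lemma eqm_sym k x y : eqm p k x y -> eqm p k y x.
Proof. by rewrite /eqm -opprB mulNr rpredN. Qed.

Lemma eqm_trans k y x z : eqm p k x y -> eqm p k y z -> eqm p k x z.
Proof.
by move=> h1 h2; rewrite /eqm -(subrKA y) mulrDl rpredD.
Qed.

Lemma eqmN k x y : eqm p k x y -> eqm p k (- x) (- y).
Proof. by move=> h; rewrite /eqm -opprD mulNr rpredN. Qed.

Lemma eqmD k x y u v : eqm p k x y -> eqm p k u v -> eqm p k (x + u) (y + v).
Proof. by move=> h1 h2; rewrite /eqm opprD addrACA mulrDl rpredD. Qed.

Lemma eqmB k x y u v : eqm p k x y -> eqm p k u v -> eqm p k (x - u) (y - v).
Proof. by move=> h1 h2; apply: eqmD => //; apply: eqmN. Qed.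

Lemma eqmMl k z x y : z \in pint p -> eqm p k x y -> eqm p k (z * x) (z * y).
Proof. by move=> pz h; rewrite /eqm -mulrBr -mulrA rpredM. Qed.

Lemma eqmMr k z x y : z \in pint p -> eqm p k x y -> eqm p k (x * z) (y * z).
Proof. by move=> pz h; rewrite ![_ * z]mulrC eqmMl. Qed.

(** From x u - y v = (x - y) u + y (u - v): only u and y have to be p-integral. *)
Lemma eqmM k x y u v : y \in pint p -> u \in pint p ->
  eqm p k x y -> eqm p k u v -> eqm p k (x * u) (y * v).
Proof.
by move=> py pu h1 h2; apply: (eqm_trans (eqmMr pu h1)); apply: eqmMl.
Qed.

Lemma eqm_pM k x y : eqm p k x y -> eqm p k.+1 (p%:R * x) (p%:R * y).
Proof. by rewrite /eqm -mulrBr exprS -mulf_div divff // mul1r. Qed.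

Lemma eqm_pM_inv k x y : eqm p k.+1 (p%:R * x) (p%:R * y) -> eqm p k x y.
Proof. by rewrite /eqm -mulrBr exprS -mulf_div divff // mul1r. Qed.

Lemma eqm_pint k x y : eqm p k x y -> y \in pint p -> x \in pint p.
Proof. by case/eqmP=> z pz -> py; rewrite rpredD // rpredM // rpredX // rpred_nat. Qed.

Lemma eqmS k x y : eqm p k.+1 x y -> eqm p k x y.
Proof.
case/eqmP=> z pz ->; apply/eqmP; exists (p%:R * z); last by rewrite exprSr mulrA.
by rewrite rpredM ?rpred_nat.
Qed.

Lemma eqm_sum k m n (F G : nat -> rat) :
  (forall i, (m <= i < n)%N -> eqm p k (F i) (G i)) ->
  eqm p k (\sum_(m <= i < n) F i) (\sum_(m <= i < n) G i).
Proof.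
move=> h; rewrite big_nat [X in eqm _ _ _ X]big_nat.
by apply: (big_rec2 (eqm p k)) => [|i x y /h ? ?]; [apply: eqm_refl|apply: eqmD].
Qed.

Lemma expn_gt1 k : (1 < p ^ k.+1)%N.
Proof. by rewrite -(exp1n k.+1) ltn_exp2r // prime_gt1. Qed.

Lemma unit_natr_Zp k d : coprime p d -> (d%:R : 'Z_(p ^ k.+1)) \is a GRing.unit.
Proof. by move=> cpd; rewrite unitZpE ?expn_gt1 // coprimeXl. Qed.

(** The passage from rationals to residues: the difference is p^(k+1) z with z p-integral, and
    p^(k+1) is zero in the target. *)
Lemma reduces_eqm k x y (u v : 'Z_(p ^ k.+1)) :
  eqm p k.+1 x y -> reduces p x u -> reduces p y v -> u = v.
Proof.
have unitR := @unit_natr_Zp k.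
case/eqmP=> z pz -> [_ <-] ry; case: (ry) => _ <-.
have rz : reduces p z (ratr z : 'Z_(p ^ k.+1)) by split.
have [_ ->] := reducesD unitR ry (reducesM unitR (reducesX unitR k.+1 (reduces_natr _ _ p)) rz).
by case: ry => _ <-; rewrite -natrX pchar_Zp ?expn_gt1 // mul0r addr0.
Qed.

(** * Units of the form 1 + p u modulo p^2 *)

Definition first_order x u := u \in pint p /\ eqm p 2 x (1 + p%:R * u).

Lemma first_order_pint x u : first_order x u -> x \in pint p.
Proof.
by case=> pu /eqm_pint; apply; rewrite rpredD ?rpred1 // rpredM // rpred_nat.
Qed.

Lemma first_orderE u : u \in pint p -> first_order (1 + p%:R * u) u.
Proof. by split=> //; apply: eqm_refl. Qed.

Lemma first_order1 : first_order 1 0.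
Proof. by split; [apply: rpred0|rewrite mulr0 addr0; apply: eqm_refl]. Qed.

(** The cross term p^2 u v disappears, so u behaves like a logarithm of x. *)
Lemma first_orderM x y u v :
  first_order x u -> first_order y v -> first_order (x * y) (u + v).
Proof.
move=> hx hy; have py := first_order_pint hy.
case: hx hy => pu hx [pv hy]; split; first exact: rpredD.
have p1u : 1 + p%:R * u \in pint p by rewrite rpredD ?rpred1 // rpredM // rpred_nat.
apply: eqm_trans (eqmM p1u py hx hy) _.
apply/eqmP; exists (u * v); first exact: rpredM.
by ring.
Qed.

Lemma first_orderW x u v : v \in pint p -> eqm p 1 u v ->
  first_order x u -> first_order x v.
Proof.
move=> pv uv [pu hx]; split=> //; apply: eqm_trans hx _.
by apply: eqmD; [apply: eqm_refl|apply: eqm_pM].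
Qed.

(** Write x = 1 + p s. Its numerator over [denq s] is m = [denq s] + p [numq s], prime to p because
    [denq s] is. *)
Lemma pint_inv x : x \in pint p -> eqm p 1 x 1 -> x != 0 /\ x^-1 \in pint p.
Proof.
move=> px /eqmP[s ps ->]; rewrite expr1.
set m := denq s + p%:Z * numq s.
have cm : coprime p `|m|.
  have: coprimez p%:Z m by rewrite /coprimez /m addrC mulrC gcdzMDl; apply: ps.
  by [].
have m0 : m != 0.
  by apply: contraTneq cm => ->; rewrite /coprime gcdn0 neq_ltn prime_gt1 ?orbT.
have E : (1 + p%:R * s) * (denq s)%:~R = m%:~R.
  by rewrite intrD intrM numqE; ring.
have d0 : (denq s)%:~R != 0 :> rat by rewrite intr_eq0 denq_neq0.
have -> : 1 + p%:R * s = m%:~R / (denq s)%:~R by rewrite -E mulfK.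
rewrite mulf_neq0 ?invr_eq0 ?intr_eq0 //; split=> //.
rewrite invfM invrK mulrC rpredM ?rpred_int //.
(* The sign of m goes to the numerator, since [pintP] takes a positive natural denominator. *)
apply: (@pintP p _ `|m| (sgz m)) => //; first by rewrite absz_gt0.
have -> : `|m|%N%:R = (`|m|%N : int)%:~R :> rat by [].
by rewrite abszEsg intrM mulrC mulfK // intr_eq0.
Qed.

Lemma first_orderV x u : first_order x u -> x != 0 /\ first_order x^-1 (- u).
Proof.
move=> hx; case: (hx) => pu hx2; have px := first_order_pint hx.
have [x0 pV] : x != 0 /\ x^-1 \in pint p.
  apply: pint_inv => //; apply: eqm_trans (eqmS hx2) _.
  by apply/eqmP; exists u.
split=> //; split; first by rewrite rpredN.
have pNu : - u \in pint p by rewrite rpredN.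
have [_] := first_orderM hx (first_orderE pNu).
rewrite subrr mulr0 addr0 => /(eqmMl pV); rewrite mulKf // mulr1.
exact: eqm_sym.
Qed.

Lemma first_order_div x y u v :
  first_order x u -> first_order y v -> first_order (x / y) (u - v).
Proof. by move=> hx /first_orderV[_]; apply: first_orderM. Qed.

(** * The products P_n(a + p t) to first order *)

Lemma pint_harm r n : (n < p)%N -> harm r n \in pint p.
Proof.
move=> np; apply: pint_sum_nat => i /andP[_ ?].
by rewrite -exprVn rpredX // pint_ltV //; lia.
Qed.

(** The quotient is the product of the 1 + p z/i for i up to n, where i < p is invertible; the
    logarithms z/i add up. *)
Lemma rising_first_order z n : z \in pint p -> (n < p)%N ->
  first_order (rising (p%:R * z) n / n`!%:R) (z * harm 1 n).
Proof.
move=> pz; elim: n => [|n IHn] np.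
  by rewrite rising0 divr1 harm_0 mulr0; apply: first_order1.
have -> : rising (p%:R * z) n.+1 / n.+1`!%:R
    = rising (p%:R * z) n / n`!%:R * (1 + p%:R * (z / n.+1%:R)).
  have f0 : n`!%:R != 0 :> rat by rewrite natr_neq0 ?fact_gt0.
  have n0 : n.+1%:R != 0 :> rat by rewrite natr_neq0.
  rewrite risingS factS natrM; move: n.+1%:R n0 => c n0.
  by field; rewrite f0 n0.
rewrite harm_S [z * (_ + _)]mulrDr expr1; apply: first_orderM; first exact/IHn/ltnW.
by apply: first_orderE; rewrite rpredM // pint_ltV.
Qed.

(** Modulo p, 1/(p - j) is -1/j. Hence H_(p-1) vanishes (the case a = 0), and each step in a removes
    1/(p-1-a) on the left and adds 1/(a+1) on the right. *)
Lemma harm_reflect a : (2 < p)%N -> (a < p)%N -> eqm p 1 (harm 1 (p.-1 - a)) (harm 1 a).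
Proof.
move=> p2; elim: a => [|a IHa] ap.
  rewrite subn0 harm_0.
  have E : harm 1 p.-1 = \sum_(1 <= j < p.-1.+1) ((p - j)%N%:R)^-1.
    rewrite /harm big_nat_rev /=; apply: eq_big_nat => i /andP[i1 i2].
    by rewrite expr1; congr (_%:R^-1); lia.
  (* Adding the reversed sum pairs 1/j + 1/(p-j) = p/(j(p-j)). *)
  have S2 : eqm p 1 (2%:R * harm 1 p.-1) 0.
    rewrite mulr2n mulrDl mul1r {2}E /harm -big_split /=.
    have Z : \sum_(1 <= j < p.-1.+1) 0 = 0 :> rat by rewrite big1.
    rewrite -[X in eqm _ _ _ X]Z.
    apply: eqm_sum => i /andP[i1 i2]; apply/eqmP.
    exists ((i%:R)^-1 * ((p - i)%N%:R)^-1).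
      by rewrite rpredM // pint_ltV //; lia.
    have h1 : i%:R != 0 :> rat by rewrite natr_neq0.
    have h2 : (p - i)%N%:R != 0 :> rat by rewrite natr_neq0; lia.
    move: h2; rewrite natrB; last by lia.
    by move=> h2; field; rewrite h1 h2.
  have p2V : (2%:R)^-1 \in pint p by apply: pint_ltV.
  have := eqmMl p2V S2; rewrite mulKf ?mulr0 //.
have := IHa (ltnW ap).
have -> : (p.-1 - a = (p.-1 - a.+1).+1)%N by lia.
rewrite !harm_S; set m := (p.-1 - a.+1)%N => h.
have := eqmB h (eqm_refl 1 (m.+1%:R ^+ 1)^-1); rewrite addrK.
move/eqm_trans; apply; apply: eqmD; first exact: eqm_refl.
apply/eqmP.
exists (- ((a.+1%:R)^-1 * (m.+1%:R)^-1)).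
  by rewrite rpredN rpredM // pint_ltV // /m; lia.
have h1 : m.+1%:R != 0 :> rat by rewrite natr_neq0.
have h2 : a.+1%:R != 0 :> rat by rewrite natr_neq0.
have -> : p%:R = a.+1%:R + m.+1%:R :> rat by rewrite -natrD /m; congr _%:R; lia.
move: m.+1%:R a.+1%:R h1 h2 => b c h1 h2.
by field; rewrite h1 h2.
Qed.

Lemma natr_factS n : n.+1`!%:R = n.+1%:R * n`!%:R :> rat.
Proof. by rewrite factS natrM. Qed.

Lemma fact_neq0 n : n`!%:R != 0 :> rat. Proof. by rewrite natr_neq0 ?fact_gt0. Qed.

(** Apply [sq_prod_rising] with y = p t and n = p - 1. Two factors are divisible by p, namely p t
    and p t + p; the rest, divided by factorials, is a quotient of rising factorials at multiples of
    p. *)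
Lemma sq_prod_full a (t : rat) : (2 < p)%N -> (0 < a < p)%N -> t \in pint p ->
  a%:R + p%:R * t != 0 ->
  exists2 v, first_order v (2%:R * harm 1 a - (t + 1) / a%:R) &
    sq_prod (a%:R + p%:R * t) p.-1
      = p%:R ^+ 2 * t * (t + 1) / ((a%:R + p%:R * t) * a%:R) * v.
Proof.
case: a => // b p2 /andP[_ bp] pt x0.
have pt1 : t + 1 \in pint p by rewrite rpredD ?rpred1.
have ptN : - t \in pint p by rewrite rpredN.
have pN1 : -1 \in pint p by rewrite rpredN rpred1.
have pp : (p.-1 < p)%N by lia.
have pb : (p.-1 - b.+1 < p)%N by lia.
exists (rising (p%:R * t) p.-1 / p.-1`!%:R * (rising (p%:R * (t + 1)) b / b`!%:R)
  * (rising (p%:R * - t) (p.-1 - b.+1) / (p.-1 - b.+1)`!%:R)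
  / (rising (p%:R * -1) b.+1 / b.+1`!%:R)).
  have := first_order_div (first_orderM (first_orderM
    (rising_first_order pt pp) (rising_first_order pt1 (ltnW bp)))
    (rising_first_order ptN pb)) (rising_first_order pN1 bp).
  apply: first_orderW.
    by rewrite rpredB ?rpredM ?pint_harm ?rpred_nat ?pint_ltV.
  (* The logarithm is t H_(p-1) + (t+1) H_b - t H_(p-1-a) + H_a with a = b + 1; modulo p the first
     term vanishes and H_(p-1-a) becomes H_a. *)
  have /eqmP[z1 pz1 ->] := harm_reflect p2 bp.
  have := @harm_reflect 0 p2 (ltnW (ltnW p2)).
  rewrite subn0 harm_0 => /eqmP[z2 pz2 ->].
  apply/eqmP; exists (t * (z2 - z1)); first by rewrite rpredM ?rpredB.
  by rewrite harm_S !expr1; ring.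
(* The product (p-a)...(p-1) is (-1)^a times [rising (- p) a]; this is where the divisor in the
   witness comes from. *)
have F_split : p.-1`!%:R = (p.-1 - b.+1)`!%:R * ((-1) ^+ b.+1 * rising (p%:R * -1) b.+1) :> rat.
  rewrite -rising_reflect !fact_rising mulrN1 opprK.
  have -> : p%:R - b.+2%:R = (p.-1 - b.+1)%N%:R :> rat.
    by rewrite -natrB; [congr _%:R; lia|lia].
  by rewrite -[X in rising X b.+1]add0r -rising_add subnK //; lia.
(* The factor of index p is p t + p; past it the product restarts as a rising factorial at p (t +
   1). *)
have R1 : rising (p%:R * t) (p.-1 + b.+1)
   = rising (p%:R * t) p.-1 * (p%:R * (t + 1)) * rising (p%:R * (t + 1)) b.
  have -> : (p.-1 + b.+1 = p.-1.+1 + b)%N by rewrite addnS.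
  by rewrite rising_add risingS prednK ?prime_gt0 // [p%:R * (t + 1)]mulrDr mulr1.
have a_n : (0 < b.+1 <= p.-1)%N by lia.
have := sq_prod_rising (p%:R * t) a_n; rewrite R1 -mulrN.
have := fact_neq0 p.-1; have := fact_neq0 (p.-1 - b.+1).
rewrite F_split factS natrM.
have := fact_neq0 b; have := natr_neq0 (ltn0Sn b).
move: x0.
move: (sq_prod _ _) (rising _ p.-1) (rising _ (_ - _)) (rising _ b.+1) (rising _ b).
move: (p.-1 - b.+1)`!%:R b`!%:R b.+1%:R => f3 fb a P r1 r3 r4 rb x0 a0 fb0 f30.
rewrite -signr_odd; case: (odd _); rewrite ?expr1 ?expr0 ?mul1r ?mulN1r.
  rewrite mulrN oppr_eq0 mulf_eq0 negb_or => /andP[_ r40] E.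
  have -> : P = (- (p%:R * t) * (r1 * (p%:R * (t + 1)) * rb) * r3) / ((a + p%:R * t) * (- (f3 * r4)) ^+ 2).
    by rewrite -E mulrC mulKf // mulf_neq0 // expf_neq0 // oppr_eq0 mulf_neq0.
  by field; rewrite r40 f30 fb0 a0 x0.
rewrite mulf_eq0 negb_or => /andP[_ r40] E.
have -> : P = ((p%:R * t) * (r1 * (p%:R * (t + 1)) * rb) * r3) / ((a + p%:R * t) * (f3 * r4) ^+ 2).
  by rewrite -E mulrC mulKf // mulf_neq0 // expf_neq0 // mulf_neq0.
by field; rewrite r40 f30 fb0 a0 x0.
Qed.

Lemma pint_oddharm n a : p = n.*2.+1 -> (a <= n)%N -> oddharm a \in pint p.
Proof.
move=> pE an; apply: pint_sum_nat => i /andP[i1 i2].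
by rewrite pint_ltV //; lia.
Qed.

(** Raising a to a + 1 multiplies the quotient by -(n+a+1)/(n-a). With d = 2a + 1 and 2n + 1 = p
    this is (1 + p/d)/(1 - p/d), of logarithm 2/d. *)
Lemma fact_ratio n a : p = n.*2.+1 -> (a <= n)%N ->
  first_order ((-1) ^+ a * (n + a)`!%:R * (n - a)`!%:R / n`!%:R ^+ 2) (2%:R * oddharm a).
Proof.
move=> pE; elim: a => [|a IHa] an.
  rewrite addn0 subn0 mul1r expr2 divff ?mulf_neq0 ?fact_neq0 //.
  by rewrite /oddharm big_geq // mulr0; apply: first_order1.
have pa : (a.*2.+1%:R)^-1 \in pint p by apply: pint_ltV; lia.
have paN : - (a.*2.+1%:R)^-1 \in pint p by rewrite rpredN.
have := first_orderM (IHa (ltnW an)) (first_order_div (first_orderE pa) (first_orderE paN)).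
have -> : 2%:R * oddharm a + ((a.*2.+1%:R)^-1 - - (a.*2.+1%:R)^-1) = 2%:R * oddharm a.+1.
  rewrite /oddharm [in RHS]big_nat_recr //=.
  have -> : (2 * a.+1 - 1 = a.*2.+1)%N by lia.
  by rewrite opprK; ring.
congr first_order.
have [c nE] : exists c, n = (a.+1 + c)%N by exists (n - a.+1)%N; rewrite subnKC.
rewrite nE addKn; rewrite nE in pE; have -> : (a.+1 + c - a = c.+1)%N by lia.
rewrite addnS (natr_factS (a.+1 + c + a)) (natr_factS c) [_ ^+ a.+1]exprS.
have d0 : a.*2.+1%:R != 0 :> rat by rewrite natr_neq0.
have c0 : c.+1%:R != 0 :> rat by rewrite natr_neq0.
have -> : (a.+1 + c + a).+1%:R = a.*2.+1%:R + c.+1%:R :> rat.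
  by rewrite -natrD; congr _%:R; lia.
have -> : p%:R = a.*2.+1%:R + 2%:R * c.+1%:R :> rat.
  by rewrite -natrM -natrD; congr _%:R; lia.
have := fact_neq0 (a.+1 + c).
move: a.*2.+1%:R c.+1%:R (a.+1 + c)`!%:R d0 c0 => d e f d0 e0 f0; field.
(* This side condition is d - p, the numerator of 1 - p/d. *)
have -> : d + (d + 2%:R * e) * -1 = - (2%:R * e) by ring.
by rewrite f0 d0 oppr_eq0 mulf_neq0.
Qed.

(** As n + a < p, only p t is divisible by p. The logarithms t H_(n+a) and -t H_(n-a) of the two
    rising factorials cancel modulo p because (n+a) + (n-a) = p - 1, which leaves that of
    [fact_ratio]. *)
Lemma sq_prod_half n a (t : rat) : p = n.*2.+1 -> (0 < a <= n)%N -> t \in pint p ->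
  a%:R + p%:R * t != 0 ->
  exists2 v, first_order v (2%:R * oddharm a) &
    sq_prod (a%:R + p%:R * t) n = p%:R * t / (a%:R + p%:R * t) * v.
Proof.
move=> pE /andP[a0 an] pt x0.
have p2 : (2 < p)%N by lia.
have ptN : - t \in pint p by rewrite rpredN.
have l1 : (n + a < p)%N by lia.
have l2 : (n - a < p)%N by lia.
exists ((-1) ^+ a * (n + a)`!%:R * (n - a)`!%:R / n`!%:R ^+ 2
  * (rising (p%:R * t) (n + a) / (n + a)`!%:R)
  * (rising (p%:R * - t) (n - a) / (n - a)`!%:R)).
  have := first_orderM (first_orderM (fact_ratio pE an) (rising_first_order pt l1))
    (rising_first_order ptN l2).
  apply: first_orderW; first by rewrite rpredM ?rpred_nat ?(pint_oddharm pE).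
  have := harm_reflect p2 l2.
  have -> : (p.-1 - (n - a) = n + a)%N by lia.
  case/eqmP=> z pz ->; apply/eqmP; exists (t * z); first exact: rpredM.
  by ring.
have := @sq_prod_rising (p%:R * t) a n; rewrite a0 an => /(_ isT); rewrite -mulrN.
have := fact_neq0 n; have := fact_neq0 (n + a); have := fact_neq0 (n - a).
move: x0; move: n`!%:R (n + a)`!%:R (n - a)`!%:R (sq_prod _ _) (rising _ (n + a))
  (rising _ (n - a)) ((-1) ^+ a) => f1 f2 f3 P r1 r2 s x0 f30 f20 f10 E.
have -> : P = (s * (p%:R * t) * r1 * r2) / ((a%:R + p%:R * t) * f1 ^+ 2).
  by rewrite -E mulrC mulKf // mulf_neq0 // expf_neq0.
by field; rewrite x0 f10 f20 f30.
Qed.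

(** * Power sums, Bernoulli numbers and harmonic sums modulo p^2 *)

Lemma power_sum_bernoulli m : (m.+1 < p)%N ->
  bernoulli m \in pint p /\
  eqm p 2 (\sum_(0 <= j < p) j%:R ^+ m) (p%:R * bernoulli m).
Proof.
elim/ltn_ind: m => -[|k] IH mp.
  split; first exact: rpred1.
  under eq_bigr do rewrite expr0.
  by rewrite sumr_const_nat subn0 mulr1; apply: eqm_refl.
have pk : (k.+2%:R)^-1 \in pint p by apply: pint_ltV.
have IHi (i : 'I_k.+1) : bernoulli i \in pint p /\
    eqm p 2 (\sum_(0 <= j < p) j%:R ^+ i) (p%:R * bernoulli i).
  by apply: IH => //; have := ltn_ord i; lia.
split.
  rewrite bernoulliS rpredM ?rpredN // rpred_sum // => i _.
  by rewrite rpredM ?rpred_nat //; case: (IHi i).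
(* Solve the recurrence for its last power sum, whose coefficient k + 2 < p is invertible. The
   numbers p B_i satisfy the same recurrence with p^(k+2) replaced by 0, and p^2 divides p^(k+2). *)
have := power_sum_rec k.+1 p; rewrite big_ord_recr /= binSn.
set T := \sum_(0 <= j < p) j%:R ^+ k.+1; set S := \sum_(i < k.+1) _ => E.
have k0 : k.+2%:R != 0 :> rat by rewrite natr_neq0.
have -> : T = (k.+2%:R)^-1 * (p%:R ^+ k.+2 - S).
  by rewrite E addrAC subrr add0r mulKf.
rewrite bernoulliS mulrCA mulNr -mulrN mulr_sumr -[X in eqm _ _ _ (_ * X)]add0r.
apply: eqmMl => //; apply: eqmB.
  apply/eqmP; exists (p%:R ^+ k); first by rewrite rpredX ?rpred_nat.
  by rewrite add0r -exprD.
apply: (big_rec2 (eqm p 2)) => [|i x y _]; first exact: eqm_refl.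
apply: eqmD; rewrite mulrCA; apply: eqmMl; first exact: rpred_nat.
by case: (IHi i).
Qed.

Lemma fermat_eqm j : (0 < j < p)%N -> eqm p 1 (j%:R ^+ p.-1) 1.
Proof.
move=> /andP[j0 jp]; have := fermat_little j p_pr.
have jjp : (j <= j ^ p)%N by rewrite -{1}[j]expn1 leq_pexp2l // prime_gt0.
move/eqP; rewrite eqn_mod_dvd // => /dvdnP[z zE].
apply/eqmP; exists (z%:R / j%:R); first by rewrite rpredM ?rpred_nat ?pint_ltV.
have j0' : j%:R != 0 :> rat by rewrite natr_neq0.
apply: (mulIf j0'); rewrite -exprSr prednK ?prime_gt0 // expr1 mulrDl mul1r.
by rewrite mulrA divfK // -natrM mulnC -zE natrB // natrX addrC subrK.
Qed.

Lemma eqm_sub_expr x m : x \in pint p ->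
  eqm p 2 ((x - p%:R) ^+ m.+1) (x ^+ m.+1 - p%:R * (m.+1%:R * x ^+ m)).
Proof.
move=> px; elim: m => [|m IHm].
  by rewrite !expr1 expr0 mul1r mulr1; apply: eqm_refl.
have pxp : x - p%:R \in pint p by rewrite rpredB ?rpred_nat.
rewrite [(x - p%:R) ^+ _]exprS; apply: eqm_trans (eqmMl pxp IHm) _.
apply/eqmP; exists (m.+1%:R * x ^+ m); first by rewrite rpredM ?rpredX ?rpred_nat.
by rewrite -[in RHS]nat1r !exprS; ring.
Qed.

(* Pairing j with p-j, and the even j with the odd ones p-2i, gives two
   relations between the sum of F over ]0,p[ and those of F, G over ]0,p/2[. *)
Lemma reflected_sums n (F G : nat -> rat) c c' : p = n.*2.+1 ->
  (forall j, (0 < j < p)%N -> eqm p 2 (F (p - j)%N) (F j - p%:R * G j)) ->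
  (forall j, F j.*2 = c * F j) -> (forall j, G j.*2 = c' * G j) ->
  let T := \sum_(1 <= j < p) F j in
  let S := \sum_(1 <= j < n.+1) F j in
  let S' := \sum_(1 <= j < n.+1) G j in
  eqm p 2 T (2%:R * S - p%:R * S') /\
  eqm p 2 T (2%:R * c * S - p%:R * (c' * S')).
Proof.
move=> pE hR hF hG T S S'; split.
  have -> : 2%:R * S - p%:R * S' = S + \sum_(1 <= j < n.+1) (F j - p%:R * G j).
    by rewrite sumrB -mulr_sumr -/S -/S'; ring.
  rewrite /T {2}pE sum_fold -pE; apply: eqmD; first exact: eqm_refl.
  by apply: eqm_sum => j /andP[j1 j2]; apply: hR; lia.
have -> : 2%:R * c * S - p%:R * (c' * S') = \sum_(1 <= j < n.+1) F j.*2
    + \sum_(1 <= j < n.+1) (F j.*2 - p%:R * G j.*2).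
  have SF : \sum_(1 <= j < n.+1) F j.*2 = c * S by rewrite mulr_sumr; apply: eq_bigr.
  have SG : \sum_(1 <= j < n.+1) G j.*2 = c' * S' by rewrite mulr_sumr; apply: eq_bigr.
  by rewrite sumrB -mulr_sumr SF SG; ring.
rewrite /T {2}pE sum_parity -pE; apply: eqmD; first exact: eqm_refl.
by apply: eqm_sum => j /andP[j1 j2]; apply: hR; lia.
Qed.

(** By Fermat 1/j^3 is j^(p-4) modulo p, which up to the factor p - 3 is the derivative of j^(p-3).
    So [reflected_sums] with F j = j^(p-3) links this half sum to p B_(p-3). *)
Lemma half_sum_bernoulli n : (5 < p)%N -> p = n.*2.+1 ->
  eqm p 1 (harm 3 n) (- 2%:R * bernoulli (p - 3)).
Proof.
move=> p5 pE; have [m mE] : exists m, p = (m.+1 + 3)%N by exists (p - 4)%N; lia.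
have -> : (p - 3 = m.+1)%N by lia.
have [|pB hT] := @power_sum_bernoulli m.+1; first by lia.
set B := bernoulli m.+1 in pB hT *.
set S' := \sum_(1 <= j < n.+1) (j%:R : rat) ^+ m.
have pS' : S' \in pint p by apply: pint_sum_nat => i _; rewrite rpredX ?rpred_nat.
have S'E : eqm p 1 (harm 3 n) S'.
  apply: eqm_sum => j /andP[j1 j2]; apply: eqm_sym.
  have jp : (0 < j < p)%N by lia.
  have j0 : j%:R != 0 :> rat by rewrite natr_neq0.
  have pj : (j%:R ^+ 3)^-1 \in pint p.
    by rewrite -exprVn rpredX // pint_ltV //; lia.
  have := eqmMl pj (fermat_eqm jp); rewrite mulr1.
  have -> : (p.-1 = 3 + m)%N by lia.
  by rewrite exprD mulKf // expf_neq0.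
apply: eqm_trans S'E _.
have hR j : (0 < j < p)%N ->
    eqm p 2 ((p - j)%N%:R ^+ m.+1) (j%:R ^+ m.+1 - p%:R * (m.+1%:R * j%:R ^+ m)).
  (* The exponent p - 3 is even, so p - j may be replaced by j - p. *)
  move=> /andP[_ jp]; have -> : (p - j)%N%:R ^+ m.+1 = (j%:R - p%:R) ^+ m.+1 :> rat.
    have odd_m : odd m.+1 = false by lia.
    by rewrite natrB ?(ltnW jp) // -opprB exprNn -signr_odd odd_m mul1r.
  by apply: eqm_sub_expr; rewrite rpred_nat.
have [||h1 h2] := @reflected_sums n (fun j => j%:R ^+ m.+1)
  (fun j => m.+1%:R * j%:R ^+ m) (2%:R ^+ m.+1) (2%:R ^+ m) pE hR.
- by move=> j; rewrite -mul2n natrM exprMn.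
- by move=> j; rewrite -mul2n natrM exprMn mulrCA.
have TE : \sum_(0 <= j < p) j%:R ^+ m.+1 = \sum_(1 <= j < p) j%:R ^+ m.+1 :> rat.
  by rewrite big_ltn ?prime_gt0 // expr0n add0r.
rewrite TE in hT; move: h1 h2; rewrite -mulr_sumr -/S'.
move: (\sum_(1 <= j < n.+1) _) (\sum_(1 <= j < p) _) => S T in hT *.
move=> /(eqm_trans (eqm_sym hT)) h1 /(eqm_trans (eqm_sym hT)) h2.
have p2X k : 2%:R ^+ k \in pint p by rewrite rpredX ?rpred_nat.
(* This combination eliminates S; what remains is divisible by p, and dividing leaves (1 - 2r) B = r
   (m+1) S' modulo p. *)
have := eqmB h2 (eqmMl (p2X m.+1) h1); rewrite exprS; set r := 2%:R ^+ m.
have -> : p%:R * B - 2%:R * r * (p%:R * B) = p%:R * ((1 - 2%:R * r) * B) by ring.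
have -> : 2%:R * (2%:R * r) * S - p%:R * (r * (m.+1%:R * S'))
    - 2%:R * r * (2%:R * S - p%:R * (m.+1%:R * S'))
  = p%:R * (r * m.+1%:R * S') by ring.
move=> /eqm_pM_inv/eqmP[w pw wE].
have two_p : (0 < 2 < p)%N by lia.
have /eqmP[z pz] := fermat_eqm two_p.
have -> : (p.-1 = m + 3)%N by lia.
rewrite exprD -/r => zE.
have p3V : (3%:R)^-1 \in pint p by apply: pint_ltV; lia.
have -> : S' = - (3%:R)^-1 * (- 3%:R * S') by field.
have -> : - 2%:R * B = - (3%:R)^-1 * (6%:R * B) by field.
apply: eqmMl; first by rewrite rpredN.
(* Modulo p one has 8 r = 1 and m + 1 = -3, whence 6 B = -3 S'. The witness collects the errors: z
   from 8 r = 1 + p z, S' from m + 1 = p - 3, and w from the elimination. *)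
apply/eqm_sym/eqmP; exists (2%:R * z * B + S' + z * (p%:R - 3%:R) * S' + 8%:R * w).
  by rewrite !rpredD ?rpredM ?rpredB ?rpred_nat.
have m1 : m.+1%:R = p%:R - 3%:R :> rat by rewrite {1}mE natrD addrK.
have rE : r = (1 + p%:R ^+ 1 * z) / 8%:R by rewrite -zE; field.
move: wE; rewrite m1 rE !expr1 => wE.
have -> : 6%:R * B = 8%:R * ((1 - 2%:R * ((1 + p%:R * z) / 8%:R)) * B) + 2%:R * p%:R * z * B by field.
by rewrite wE; field.
Qed.

(** Let T, X be the full and half sums of 1/j^2 and Y the half sum of 1/j^3. [reflected_sums] gives
    T = 2X + 2pY and 4T = 2X + pY modulo p^2. Hence 3T = -pY and 2X = T - 2pY; then insert Y = -2
    B_(p-3). *)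
Lemma harm2_congr n : (5 < p)%N -> p = n.*2.+1 ->
  eqm p 2 (harm 2 p.-1) (p%:R * (2%:R / 3%:R * bernoulli (p - 3))) /\
  eqm p 2 (harm 2 n) (p%:R * (7%:R / 3%:R * bernoulli (p - 3))).
Proof.
move=> p5 pE; have hY := eqm_pM (half_sum_bernoulli p5 pE).
have hR j : (0 < j < p)%N ->
    eqm p 2 (((p - j)%N%:R ^+ 2)^-1) ((j%:R ^+ 2)^-1 - p%:R * (- 2%:R * (j%:R ^+ 3)^-1)).
  move=> /andP[j0 jp]; apply/eqmP.
  (* The exact remainder of 1/(p-j)^2 = 1/j^2 + 2p/j^3 + ..., divided by p^2. *)
  exists ((3%:R * j%:R - 2%:R * p%:R) * ((j%:R)^-1 ^+ 3 * ((p - j)%N%:R)^-1 ^+ 2)).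
    rewrite rpredM ?rpredB ?rpredM ?rpredX ?rpred_nat // pint_ltV //; lia.
  have h1 : j%:R != 0 :> rat by rewrite natr_neq0.
  have : (p - j)%N%:R != 0 :> rat by rewrite natr_neq0 //; lia.
  rewrite natrB ?(ltnW jp) // => h2.
  by field; rewrite h1 h2.
have [||h1 h2] := @reflected_sums n (fun j => (j%:R ^+ 2)^-1)
  (fun j => - 2%:R * (j%:R ^+ 3)^-1) (4%:R^-1) (8%:R^-1) pE hR.
- move=> j; rewrite -mul2n natrM exprMn invfM; congr (_ * _).
- move=> j; rewrite -mul2n natrM exprMn invfM mulrCA; congr (_ * _).
move: h1 h2; rewrite -mulr_sumr.
have -> : \sum_(1 <= j < p) (j%:R ^+ 2)^-1 = harm 2 p.-1.
  by rewrite /harm prednK ?prime_gt0.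
rewrite -/(harm 2 n) -/(harm 3 n).
move: (harm 2 p.-1) (harm 2 n) (harm 3 n) (bernoulli (p - 3)) hY => T X Y B hY h1 h2.
have p3V : (3%:R)^-1 \in pint p by apply: pint_ltV; lia.
have p2V : (2%:R)^-1 \in pint p by apply: pint_ltV; lia.
have hT : eqm p 2 T (p%:R * (2%:R / 3%:R * B)).
  have -> : T = (3%:R)^-1 * (4%:R * T - T) by field.
  have -> : p%:R * (2%:R / 3%:R * B) = (3%:R)^-1 * - (p%:R * (- 2%:R * B)) by field.
  apply: eqmMl => //; apply: eqm_trans (eqmN hY).
  have := eqmB (eqmMl (rpred_nat _ 4) h2) h1.
  by congr eqm; field.
split=> //.
have -> : X = (2%:R)^-1 * ((2%:R * X - p%:R * (- 2%:R * Y)) - 2%:R * (p%:R * Y)) by field.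
have -> : p%:R * (7%:R / 3%:R * B)
   = (2%:R)^-1 * (p%:R * (2%:R / 3%:R * B) - 2%:R * (p%:R * (- 2%:R * B))) by field.
apply: eqmMl => //; apply: eqmB; last by apply: eqmMl; rewrite ?rpred_nat.
exact: eqm_trans (eqm_sym h1) hT.
Qed.

(** * Both congruences over the rationals *)

Ltac pint_closed := repeat first
  [ assumption | apply: rpred_nat | apply: rpred1 | apply: rpredX
  | apply: rpredN | apply: rpredD | apply: rpredM ].

(** Serves both sums: h is H_a or the odd harmonic sum, e is 2t + 1 or t, and p b is the value of
    H_n^(2). In the term 2 p h / x^2 the x may become a, since they agree modulo p. *)
Lemma bracket_congr a (t x w h e b H : rat) : (0 < a < p)%N -> x = a%:R + p%:R * t ->
  x != 0 -> x^-1 \in pint p -> t \in pint p -> h \in pint p -> b \in pint p ->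
  first_order w (2%:R * h - e / a%:R) -> eqm p 2 H (p%:R * b) ->
  eqm p 2 (w * ((x ^+ 2)^-1 + H))
    ((x ^+ 2)^-1 + p%:R * b + 2%:R * p%:R * h / a%:R ^+ 2
      - p%:R * e * ((x ^+ 2)^-1 / a%:R)).
Proof.
move=> /andP[a0 ap] xE x0 pxV pt ph pb hw hH; case: (hw) => pu wE.
have paV : (a%:R)^-1 \in pint p by apply: pint_ltV.
have a0' : a%:R != 0 :> rat by rewrite natr_neq0.
have pB : p%:R * b \in pint p by rewrite rpredM ?rpred_nat.
have pR : (x ^+ 2)^-1 + H \in pint p.
  by rewrite rpredD ?(eqm_pint hH) // -exprVn rpredX.
have pL : 1 + p%:R * (2%:R * h - e / a%:R) \in pint p.
  by rewrite rpredD ?rpred1 // rpredM ?rpred_nat.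
apply: eqm_trans (eqmM pL pR wE (eqmD (eqm_refl _ _) hH)) _.
(* The first summand is the product of the two terms in p; the second comes from 1/x^2 - 1/a^2 = -p
   t (2a + p t)/(x^2 a^2). *)
apply/eqmP; exists ((2%:R * h - e / a%:R) * b
   - 2%:R * h * t * (2%:R * a%:R + p%:R * t) * ((x^-1) ^+ 2 * (a%:R)^-1 ^+ 2)).
  apply: rpredB; first exact: rpredM.
  by pint_closed.
by rewrite xE in x0 *; field; rewrite x0 a0'.
Qed.

Lemma prime_half : (5 < p)%N -> p = (p.-1./2).*2.+1.
Proof.
by move=> p5; have : odd p by [case: (even_prime p_pr) => // p2E; lia]; lia.
Qed.

(** Here P/x is p^2 t (t+1)/(x a^2) times v a/x. Moving x/a = 1 + p t/a into the unit changes
    (t+1)/a into (2t+1)/a, and the prefactor p^2 lifts the bracket from modulus p^2 to p^4. *)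
Lemma lhs_rhs1_congr a (t x : rat) : (5 < p)%N -> (0 < a < p)%N ->
  x = a%:R + p%:R * t -> x != 0 -> x^-1 \in pint p -> t \in pint p ->
  eqm p 4 (lhs x p.-1) (rhs1 p a x t).
Proof.
move=> p5 aP xE x0 pxV pt; have p2 : (2 < p)%N by lia.
case/andP: (aP) => a0 ap.
have a0' : a%:R != 0 :> rat by rewrite natr_neq0.
have paV : (a%:R)^-1 \in pint p by apply: pint_ltV.
have pE := prime_half p5.
have [h2 _] := harm2_congr p5 pE.
have pt1 : t + 1 \in pint p by rewrite rpredD ?rpred1.
have p3V : (3%:R)^-1 \in pint p by apply: pint_ltV; lia.
have [|pB _] := @power_sum_bernoulli (p - 3); first by lia.
have x0' : a%:R + p%:R * t != 0 by rewrite -xE.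
have [v hv vE] := sq_prod_full p2 aP pt x0'.
have pta : t / a%:R \in pint p by rewrite rpredM.
have [_ hx] := first_orderV (first_orderE pta).
have := first_orderM hv hx.
have -> : 1 + p%:R * (t / a%:R) = x / a%:R by rewrite xE; field; rewrite a0'.
have -> : 2%:R * harm 1 a - (t + 1) / a%:R - t / a%:R
   = 2%:R * harm 1 a - (2%:R * t + 1) / a%:R by ring.
move=> hw.
have pb : 2%:R / 3%:R * bernoulli (p - 3) \in pint p.
  exact: rpredM (rpredM (rpred_nat _ _) p3V) pB.
have := bracket_congr aP xE x0 pxV pt (pint_harm 1 ap) pb hw h2.
have pc : t * (t + 1) * (x^-1 * (a%:R)^-1 ^+ 2) \in pint p.
  by rewrite !rpredM ?rpredX.
move/(eqmMl pc)/eqm_pM/eqm_pM/(eqmD (eqm_refl _ (- (x ^+ 3)^-1))).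
rewrite lhs_closed // [in sq_prod _ _]xE vE -xE /rhs1 !ratr_rat !natrX.
by congr eqm; field; rewrite x0 a0'.
Qed.

(** The same with P/x equal to p t/(x a) times v a/x; a single p in front gives modulus p^3. *)
Lemma lhs_rhs2_congr a (t x : rat) : (5 < p)%N -> (0 < a <= p.-1./2)%N ->
  x = a%:R + p%:R * t -> x != 0 -> x^-1 \in pint p -> t \in pint p ->
  eqm p 3 (lhs x p.-1./2) (rhs2 p a x t).
Proof.
move=> p5 aP' xE x0 pxV pt; have p2 : (2 < p)%N by lia.
case/andP: (aP') => a0 an; have ap : (a < p)%N by lia.
have aP : (0 < a < p)%N by rewrite a0.
have a0' : a%:R != 0 :> rat by rewrite natr_neq0.
have paV : (a%:R)^-1 \in pint p by apply: pint_ltV.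
have pE := prime_half p5.
have [_ h2] := harm2_congr p5 pE.
have p3V : (3%:R)^-1 \in pint p by apply: pint_ltV; lia.
have [|pB _] := @power_sum_bernoulli (p - 3); first by lia.
have x0' : a%:R + p%:R * t != 0 by rewrite -xE.
have [v hv vE] := sq_prod_half pE aP' pt x0'.
have pta : t / a%:R \in pint p by rewrite rpredM.
have [_ hx] := first_orderV (first_orderE pta).
have := first_orderM hv hx.
have -> : 1 + p%:R * (t / a%:R) = x / a%:R by rewrite xE; field; rewrite a0'.
move=> hw.
have pb : 7%:R / 3%:R * bernoulli (p - 3) \in pint p.
  exact: rpredM (rpredM (rpred_nat _ _) p3V) pB.
have := bracket_congr aP xE x0 pxV pt (pint_oddharm pE an) pb hw h2.
have pc : t * (x^-1 * (a%:R)^-1) \in pint p by rewrite !rpredM.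
move/(eqmMl pc)/eqm_pM/(eqmD (eqm_refl _ (- (x ^+ 3)^-1))).
rewrite lhs_closed // [in sq_prod _ _]xE vE -xE /rhs2 !ratr_rat !natrX.
by congr eqm; field; rewrite x0 a0'.
Qed.

(** * Transfer to the rings Z/p^(k+1) *)

Lemma coprime_fact n : (n < p)%N -> coprime p n`!.
Proof.
elim: n => [|n IHn] np; first exact: coprimen1.
by rewrite factS coprimeMr coprime_lt // IHn // ltnW.
Qed.

Section Transfer.
Variable k : nat.
Local Notation R := 'Z_(p ^ k.+1).

Let unitR d : coprime p d -> (d%:R : R) \is a GRing.unit.
Proof. exact: unit_natr_Zp. Qed.

Ltac reduce := repeat (try assumption; match goal with
  | |- reduces _ (ratr _) _ => apply: reduces_ratr
  | |- reduces _ (_ + _) _ => apply: (reducesD unitR)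
  | |- reduces _ (- _) _ => apply: reducesN
  | |- reduces _ (_ * _) _ => apply: (reducesM unitR)
  | |- reduces _ (_ ^+ _) _ => apply: (reducesX unitR)
  | |- reduces _ 1 _ => apply: reduces1
  | |- reduces _ _%:R _ => apply: reduces_natr
  end).

(** With x + k cancelled in [binom_neg_div], each term is a polynomial in x with p-integral
    coefficients, so it reduces even when p divides x + k. *)
Lemma reduces_lhs (x : rat) (y : R) n : (n < p)%N -> reduces p x y ->
  reduces p (lhs x n) (lhs y n).
Proof.
move=> np xy; rewrite /lhs big_nat [X in reduces _ _ X]big_nat.
apply: (reduces_sum unitR) => i /andP[_ i_n].
have ip : (i < p)%N by lia.
have pf : (i`!%:R)^-1 \in pint p by rewrite pint_natV // coprime_fact.
rewrite /summand /binomR /binom_neg_div; reduce.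
- exact: pint_harm.
- by apply: (reduces_prod unitR) => j _; reduce.
- by apply: (reduces_prod unitR) => j _; reduce.
Qed.

Section Rhs.
Variables (a : nat) (x t : rat) (y u : R).
Hypotheses (p5 : (5 < p)%N) (x0 : x != 0) (pxV : x^-1 \in pint p).
Hypotheses (xy : reduces p x y) (tu : reduces p t u).

Let reduces_xV m : reduces p (x ^+ m)^-1 (y ^+ m)^-1.
Proof.
apply: (reducesV unitR); first exact: expf_neq0.
- by rewrite -exprVn rpredX.
- exact: (reducesX unitR).
Qed.

Lemma reduces_rhs1 : (0 < a < p)%N ->
  reduces p (rhs1 p a x t) (rhs1 p a y u).
Proof.
move=> /andP[a0 ap]; have pa := pint_ltV ap.
have xV := reduces_xV 1; rewrite !expr1 in xV.
have p3V : (3%:R)^-1 \in pint p by apply: pint_ltV; lia.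
have [|pB _] := @power_sum_bernoulli (p - 3); first by lia.
have pa2 : ((a ^ 2)%N%:R)^-1 \in pint p by rewrite natrX -exprVn rpredX.
have pH : harm 1 a / (a ^ 2)%N%:R \in pint p by rewrite rpredM // pint_harm.
have p23 : 2%:R / 3%:R \in pint p by apply: rpredM; first exact: rpred_nat.
by rewrite /rhs1; reduce; apply: reduces_xV.
Qed.

Lemma reduces_rhs2 : (0 < a <= p.-1./2)%N ->
  reduces p (rhs2 p a x t) (rhs2 p a y u).
Proof.
move=> /andP[a0 an]; have ap : (a < p)%N by lia.
have pa := pint_ltV ap; have xV := reduces_xV 1; rewrite !expr1 in xV.
have p3V : (3%:R)^-1 \in pint p by apply: pint_ltV; lia.
have [|pB _] := @power_sum_bernoulli (p - 3); first by lia.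
have pa2 : ((a ^ 2)%N%:R)^-1 \in pint p by rewrite natrX -exprVn rpredX.
have pO : oddharm a \in pint p by apply: (@pint_oddharm p.-1./2) => //; apply: prime_half.
have p73 : 7%:R / 3%:R \in pint p by apply: rpredM; first exact: rpred_nat.
by rewrite /rhs2; reduce; apply: reduces_xV.
Qed.

End Rhs.
End Transfer.

End Congruence.

(** * From p-adic integers to natural representatives *)

Lemma zp_coherent_mod p (al : padic p) n : prime p -> zp_coherent al ->
  ((al n : nat) %% p)%N = zp_res al.
Proof.
move=> p_pr coh; elim: n => [|n IHn].
  have E : (Zp_trunc (p ^ 1)).+2 = p by rewrite Zp_cast ?expn1 ?prime_gt1.
  by rewrite modn_small // -[X in (_ < X)%N]E ltn_ord.
by rewrite -IHn -(coh n) modn_dvdm // dvdn_exp.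
Qed.

Theorem theorem1p3 (p : nat) (al : padic p) :
  prime p -> (5 < p)%N -> zp_coherent al -> zp_res al != 0%N ->
  zp_eqmod 4 (zp_lhs al p.-1) (zp_rhs1 al) /\
  ((zp_res al <= p.-1./2)%N -> zp_eqmod 3 (zp_lhs al p.-1./2) (zp_rhs2 al)).
Proof.
move=> p_pr p5 coh res0; set a := zp_res al in res0 *.
have a0 : (0 < a)%N by rewrite lt0n.
have modA m : ((al m : nat) %% p)%N = a := zp_coherent_mod m p_pr coh.
have ap : (a < p)%N by rewrite -(modA 0%N) ltn_mod; lia.
(* The representative A is taken one level higher, at n + 1: division by p loses one digit, and t is
   needed modulo p^(n+1). *)
have lift n : exists A t : nat, [/\ (A = a + p * t)%N,
    al n = A%:R & zp_t al n = t%:R].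
  exists (al n.+1 : nat), (((al n.+1 : nat) - a) %/ p)%N; split=> //.
    rewrite -(modA n.+1); move: (al n.+1 : nat) => v.
    have -> : (v - v %% p = v %/ p * p)%N by rewrite {1}(divn_eq v p) addnK.
    by rewrite mulnK ?prime_gt0 // addnC mulnC -divn_eq.
  by rewrite -[LHS]natr_Zp -(coh n) Zp_nat_mod // expn_gt1.
have prep n : exists x t : rat, [/\ x = a%:R + p%:R * t, x != 0, x^-1 \in pint p,
    reduces p x (al n) & reduces p t (zp_t al n)].
  have [A [t [AE -> ->]]] := lift n; exists A%:R, t%:R.
  split; [by rewrite AE natrD natrM | by rewrite natr_neq0 // AE; lia | | exact: reduces_natr | exact: reduces_natr].
  apply: pint_natV; rewrite AE addnC mulnC /coprime gcdnMDl.
  by apply: coprime_lt; rewrite ?a0.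
split=> [|an].
  (* Level n holds residues modulo p^(n+1), so modulus p^4 is read at level 3. *)
  have [x [t [xE x0 pxV xy tu]]] := prep 3%N; have [pt _] := tu.
  apply: (@reduces_eqm p p_pr 3 (lhs x p.-1) (rhs1 p a x t)).
  - by apply: lhs_rhs1_congr; rewrite ?a0.
  - by apply: reduces_lhs => //; lia.
  - by apply: reduces_rhs1; rewrite ?a0.
have [x [t [xE x0 pxV xy tu]]] := prep 2%N; have [pt _] := tu.
apply: (@reduces_eqm p p_pr 2 (lhs x p.-1./2) (rhs2 p a x t)).
- by apply: lhs_rhs2_congr; rewrite ?a0.
- by apply: reduces_lhs => //; lia.
- by apply: reduces_rhs2; rewrite ?a0.
Qed.
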